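(* Let $F$ be the free group on $X=\{x_1,\ldots,x_e\}$, let $H$ be a finite group of order $m$, and let $\psi\colon F\to H$ be an epimorphism. Let $\psi_i\colon F\to W=\mathbb{Z}\wr H$, the Fox derivatives $\frac{\partial}{\partial x_i}\colon F\to\mathbb{Z}F$, and $\zeta\colon\mathbb{Z}F\to\mathbb{Z}^m$ be as defined in the context. If $i\in\{1,\ldots,e\}$ and $w\in F$, then \[\psi_i(w)=\left(\psi(w),\,\zeta\left(\tfrac{\partial w}{\partial x_i}\right)\right),\] and $\zeta(\frac{\partial w}{\partial x_i})=0$ if and only if $\psi(\frac{\partial w}{\partial x_i})=0$ in $\mathbb{Z}H$.
   Context: Write $\mathbf{e}$ for the identity of $F$ and of $H$. For $x\in X$ the Fox derivative $\frac{\partial}{\partial x}\colon F\to\mathbb{Z}F$ is the unique map that sends $x$ to $\mathbf{e}$, sends all other generators in $X$ to $0$, and satisfies $\frac{\partial(uv)}{\partial x}=\left(\frac{\partial u}{\partial x}\right)v+\frac{\partial v}{\partial x}$ for all $u,v\in F$. $W=\mathbb{Z}\wr H=H\ltimes\mathbb{Z}^m$ is the regular wreath product, where the $m$ copies of $\mathbb{Z}$ are labelled by the elements of $H$. For $z\in\mathbb{Z}$, $h\in H$, $z(h)\in\mathbb{Z}^m$ denotes the element with $z$ in the position labelled $h$ and $0$ elsewhere. $H$ acts on $\mathbb{Z}^m$ on the right by $1(g)^b=1(gb)$, and the multiplication in $W$ is $(a,u)(b,v)=(ab,u^b+v)$. For $i\in\{1,\ldots,e\}$, $\psi_i\colon F\to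 W$ is the homomorphism with $\psi_i(x_j)=(\psi(x_j),0)$ for $j\neq i$ and $\psi_i(x_i)=(\psi(x_i),1(\mathbf{e}))$. The linear extension $\mathbb{Z}F\to\mathbb{Z}H$ of $\psi$ is also denoted $\psi$. The map $\zeta\colon\mathbb{Z}F\to\mathbb{Z}^m$ is the composition of $\psi\colon\mathbb{Z}F\to\mathbb{Z}H$ with the additive isomorphism $\mathbb{Z}H\to\mathbb{Z}^m$ that maps each $g\in H$ to $1(g)$. *)

(* Defs.v *)
From HB Require Import structures.
From mathcomp Require Import finmap.
From mathcomp.multinomials Require Import monalg.
From mathcomp Require Import all_boot all_algebra all_fingroup.

Set Implicit Arguments.
Unset Strict Implicit.
Unset Printing Implicit Defensive.

Import GRing.Theory.
Local Open Scope ring_scope.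

Section ReducedWords.
Context {X : choiceType}.

(* The letter (x, false) stands for x and (x, true) for x^-1. *)
Definition letter_inv (l : X * bool) : X * bool := (l.1, ~~ l.2).

Definition reduced (s : seq (X * bool)) : bool :=
  sorted (fun l k => k != letter_inv l) s.

Definition push (l : X * bool) (s : seq (X * bool)) : seq (X * bool) :=
  if s is k :: s' then if k == letter_inv l then s' else l :: s else [:: l].

Definition word_mul (s t : seq (X * bool)) : seq (X * bool) := foldr push t s.

Definition word_inv (s : seq (X * bool)) : seq (X * bool) :=
  rev (map letter_inv s).

Lemma letter_invK : involutive letter_inv.
Proof. by case=> x b; rewrite /letter_inv /= negbK. Qed.

Lemma reduced_behead l s : reduced (l :: s) -> reduced s.
Proof. exact: path_sorted. Qed.

Lemma push_reduced l s : reduced s -> reduced (push l s).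
Proof.
case: s => [|k s] //= rs; case: ifP => [_|/negbT kl]; first exact: path_sorted rs.
by rewrite /reduced /= kl.
Qed.

Lemma push_cons l s : reduced (l :: s) -> push l s = l :: s.
Proof. by case: s => [|k s] //=; rewrite /reduced /= => /andP[/negPf->]. Qed.

Lemma pushK l s : reduced s -> push (letter_inv l) (push l s) = s.
Proof.
case: s => [|k s] rs /=; first by rewrite letter_invK eqxx.
case: eqP => [kl|_]; last by rewrite /= letter_invK eqxx.
by rewrite -kl push_cons.
Qed.

Lemma word_mul_reduced s t : reduced t -> reduced (word_mul s t).
Proof. by move=> rt; elim: s => //= l s; apply: push_reduced. Qed.

Lemma word_inv_reduced s : reduced s -> reduced (word_inv s).
Proof.
rewrite /reduced /word_inv rev_sorted sorted_map; apply: sub_sorted => l k /=.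
by apply: contra => /eqP ->; rewrite !letter_invK.
Qed.

Lemma word_mul_nil s : reduced s -> word_mul s [::] = s.
Proof.
elim: s => //= l s IH rs; rewrite IH ?push_cons //.
exact: reduced_behead rs.
Qed.

Lemma word_mul_push l s t :
  reduced s -> reduced t -> word_mul (push l s) t = push l (word_mul s t).
Proof.
case: s => [|k s] //= rs rt; case: eqP => //= ->.
by rewrite -{1}[l]letter_invK pushK // word_mul_reduced.
Qed.

Lemma word_mulA s t u : reduced t -> reduced u ->
  word_mul s (word_mul t u) = word_mul (word_mul s t) u.
Proof.
move=> rt ru; elim: s => //= l s ->.
by rewrite word_mul_push // word_mul_reduced.
Qed.

Lemma word_mulV s : reduced s -> word_mul (word_inv s) s = [::].
Proof.
elim: s => //= l s IH rs; rewrite /word_inv /= rev_cons -cats1.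
rewrite /word_mul foldr_cat /= letter_invK eqxx.
exact/IH/(reduced_behead rs).
Qed.

Lemma word_invK : involutive word_inv.
Proof.
by move=> s; rewrite /word_inv map_rev revK mapK //; apply: letter_invK.
Qed.

End ReducedWords.

Section FreeGroup.
Context (X : choiceType).

Record freegroup := FreeGroup
  { fword : seq (X * bool); fword_reduced : reduced fword }.

HB.instance Definition _ := [isSub for fword].
HB.instance Definition _ := [Choice of freegroup by <:].

Definition freegroup_one : freegroup := @FreeGroup [::] isT.
Definition freegroup_mul (u v : freegroup) : freegroup :=
  FreeGroup (word_mul_reduced (fword u) (fword_reduced v)).
Definition freegroup_inv (u : freegroup) : freegroup :=
  FreeGroup (word_inv_reduced (fword_reduced u)).

Fact freegroup_mulA : associative freegroup_mul.
Proof.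
by move=> u v w; apply: val_inj; rewrite /= word_mulA // fword_reduced.
Qed.

Fact freegroup_mul1 : left_id freegroup_one freegroup_mul.
Proof. by move=> u; apply: val_inj. Qed.

Fact freegroup_1mul : right_id freegroup_one freegroup_mul.
Proof. by move=> u; apply: val_inj; rewrite /= word_mul_nil ?fword_reduced. Qed.

Fact freegroup_mulV : left_inverse freegroup_one freegroup_inv freegroup_mul.
Proof. by move=> u; apply: val_inj; rewrite /= word_mulV ?fword_reduced. Qed.

Fact freegroup_Vmul : right_inverse freegroup_one freegroup_inv freegroup_mul.
Proof.
move=> u; apply: val_inj; rewrite /= -{1}[fword u]word_invK.
by rewrite word_mulV ?word_inv_reduced ?fword_reduced.
Qed.

HB.instance Definition _ := isGroup.Build freegroup
  freegroup_mulA freegroup_mul1 freegroup_1mul freegroup_mulV freegroup_Vmul.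

Definition fgen (x : X) : freegroup := @FreeGroup [:: (x, false)] isT.

End FreeGroup.

Arguments freegroup_one {X}.

Lemma fgen_ind (X : choiceType) (P : freegroup X -> Prop) :
  P 1%g ->
  (forall x u, P u -> P (fgen x * u)%g) ->
  (forall x u, P u -> P ((fgen x)^-1 * u)%g) ->
  forall u, P u.
Proof.
move=> P1 Pg PV [s]; elim: s => [|[x b] s IH] rs.
  by rewrite (_ : FreeGroup rs = 1%g) //; apply: val_inj.
have Ps := IH (reduced_behead rs).
case: b rs Ps => rs Ps; [have := PV x _ Ps | have := Pg x _ Ps].
  by congr P; apply: val_inj; rewrite /= (push_cons rs).
by congr P; apply: val_inj; rewrite /= (push_cons rs).
Qed.

Section FreeGroupLift.
Context (X : choiceType) (G : groupType) (f : X -> G).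
Local Open Scope group_scope.

Definition letter_val (l : X * bool) : G := if l.2 then (f l.1)^-1 else f l.1.

Definition word_val (s : seq (X * bool)) : G :=
  foldr (fun l g => letter_val l * g) 1 s.

(* The homomorphism extending f, i.e. the universal property of freegroup X. *)
Definition flift (u : freegroup X) : G := word_val (fword u).

Lemma letter_valV l : letter_val (letter_inv l) = (letter_val l)^-1.
Proof. by case: l => x [] //=; rewrite /letter_val /= invgK. Qed.

Lemma word_val_push l s : word_val (push l s) = letter_val l * word_val s.
Proof.
by case: s => [|k s] //=; case: eqP => //= ->; rewrite letter_valV mulKVg.
Qed.

Lemma word_val_mul s t : word_val (word_mul s t) = word_val s * word_val t.
Proof.
elim: s => [|l s IH] /=; first by rewrite mul1g.
by rewrite word_val_push IH mulgA.
Qed.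

Fact fliftM : {morph flift : u v / u * v}.
Proof. by move=> u v; rewrite /flift /= word_val_mul. Qed.

HB.instance Definition _ := isMultiplicative.Build _ _ flift fliftM.

Fact flift1 : flift 1 = 1.
Proof. by []. Qed.

HB.instance Definition _ :=
  Multiplicative_isUMagmaMorphism.Build _ _ flift flift1.

Lemma flift_gen x : flift (fgen x) = f x.
Proof. by rewrite /flift /= mulg1. Qed.

Lemma flift_unique (g : {multiplicative freegroup X -> G}) :
  (forall x, g (fgen x) = f x) -> g =1 flift.
Proof.
have g1 : g 1 = 1 by apply: (mulgI (g 1)); rewrite -gmulfM !mulg1.
have gV u : g u^-1 = (g u)^-1.
  by apply: (mulgI (g u)); rewrite -gmulfM !mulgV.
move=> gf; apply: fgen_ind => [|x u IH|x u IH]; first by rewrite g1.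
  by rewrite gmulfM fliftM gf IH flift_gen.
by rewrite gmulfM fliftM gV gf IH; congr (_ * _); rewrite /flift /= mulg1.
Qed.

End FreeGroupLift.

Lemma flift_fgen (X : choiceType) (u : freegroup X) : flift (@fgen X) u = u.
Proof.
by have /(_ idfun) <- := @flift_unique X (freegroup X) (@fgen X).
Qed.

Section GroupRing.
Context (G : groupType).

(* The integral group ring: finitely supported functions G -> int, with
   convolution as product. *)
Definition grpring : Type := {malg int[G]}.

HB.instance Definition _ := GRing.Zmodule.on grpring.

Definition grpelt (g : G) : grpring := mkmalgU g 1.

(* The additive map on the group ring extending h. *)
Definition grpring_lift (V : zmodType) (h : G -> V) (a : grpring) : V :=
  \sum_(g <- msupp a) h g *~ a@_g.

Section Lift.
Context (V : zmodType).
Implicit Types (h : G -> V) (a b : grpring).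

Lemma grpring_liftw h a (d : {fset G}) : fsubset (msupp a) d ->
  grpring_lift h a = \sum_(g <- d) h g *~ a@_g.
Proof.
move=> le; rewrite /grpring_lift (big_fset_incl _ le) //= => g _.
by move=> /mcoeff_outdom ->; rewrite mulr0z.
Qed.

Lemma grpring_lift_elt h g : grpring_lift h (grpelt g) = h g.
Proof. by rewrite (grpring_liftw _ msuppU_le) big_seq_fset1 mcoeffUU. Qed.

Fact grpring_liftB h : {morph grpring_lift h : a b / a - b}.
Proof.
move=> a b; pose d := fsetU (msupp a) (msupp b).
rewrite !(@grpring_liftw _ _ d) ?fsubsetUl ?fsubsetUr ?msuppB_le //.
by rewrite -sumrB; apply: eq_bigr => g _; rewrite mcoeffB mulrzBr.
Qed.

HB.instance Definition _ h :=
  GRing.isZmodMorphism.Build grpring V (grpring_lift h) (grpring_liftB h).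

Lemma grpring_lift_funB h1 h2 a :
  grpring_lift (fun g => h1 g - h2 g) a = grpring_lift h1 a - grpring_lift h2 a.
Proof. by rewrite -sumrB; apply: eq_bigr => g _; rewrite mulrzBl. Qed.

End Lift.

Lemma grpring_ind (P : grpring -> Prop) :
  (forall g, P (grpelt g)) -> (forall a b, P a -> P b -> P (a - b)) ->
  forall a, P a.
Proof.
move=> Pe PB a.
have P0 : P 0 by rewrite -(subrr (grpelt 1%g)); apply: PB.
have PN b : P b -> P (- b) by rewrite -(sub0r b); apply: PB.
have PD b c : P b -> P c -> P (b + c) by rewrite -{2}(opprK c) => ? /PN; exact: PB.
have -> : a = \sum_(g <- msupp a) grpelt g *~ a@_g.
  rewrite {1}[a]monalgE; apply: eq_bigr => g _.
  by rewrite /grpelt -(raddfMz (mkmalgU g)) intz.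
elim/big_ind: _ => // g _.
have Pn n : P (grpelt g *+ n) by elim: n => // n IH; rewrite mulrS; apply: PD.
by case: (a@_g) => n; [exact: Pn | apply: PN; exact: Pn].
Qed.

Definition grpring_mul (a b : grpring) : grpring :=
  grpring_lift (fun g => grpring_lift (fun k => grpelt (g * k)%g) b) a.

Fact grpring_mulBl a b c :
  grpring_mul (a - b) c = grpring_mul a c - grpring_mul b c.
Proof. exact: raddfB. Qed.

Fact grpring_mulBr a b c :
  grpring_mul a (b - c) = grpring_mul a b - grpring_mul a c.
Proof.
rewrite -grpring_lift_funB; apply: eq_bigr => g _; congr (_ *~ _).
exact: raddfB.
Qed.

Fact grpring_mul_elt g k :
  grpring_mul (grpelt g) (grpelt k) = grpelt (g * k)%g.
Proof. by rewrite /grpring_mul !grpring_lift_elt. Qed.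

Fact grpring_mulA : associative grpring_mul.
Proof.
move=> a b c; elim/grpring_ind: a => [g|a1 a2 IH1 IH2]; last first.
  by rewrite !grpring_mulBl IH1 IH2.
elim/grpring_ind: b => [k|b1 b2 IH1 IH2]; last first.
  by rewrite !(grpring_mulBl, grpring_mulBr) IH1 IH2.
elim/grpring_ind: c => [l|c1 c2 IH1 IH2]; last first.
  by rewrite !grpring_mulBr IH1 IH2.
by rewrite !grpring_mul_elt mulgA.
Qed.

Fact grpring_mul1l : left_id (grpelt 1%g) grpring_mul.
Proof.
elim/grpring_ind => [g|a b IHa IHb]; first by rewrite grpring_mul_elt mul1g.
by rewrite grpring_mulBr IHa IHb.
Qed.

Fact grpring_mul1r : right_id (grpelt 1%g) grpring_mul.
Proof.
elim/grpring_ind => [g|a b IHa IHb]; first by rewrite grpring_mul_elt mulg1.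
by rewrite grpring_mulBl IHa IHb.
Qed.

Fact grpring_mulDl : left_distributive grpring_mul +%R.
Proof.
move=> a b c; have := grpring_mulBl (a + b) b c.
by rewrite addrK => ->; rewrite subrK.
Qed.

Fact grpring_mulDr : right_distributive grpring_mul +%R.
Proof.
move=> a b c; have := grpring_mulBr a (b + c) c.
by rewrite addrK => ->; rewrite subrK.
Qed.

Fact grpring_1_neq0 : grpelt 1%g != 0.
Proof. by rewrite monalgU_eq0. Qed.

HB.instance Definition _ := GRing.Zmodule_isNzRing.Build grpring
  grpring_mulA grpring_mul1l grpring_mul1r grpring_mulDl grpring_mulDr
  grpring_1_neq0.

Lemma grpelt1 : grpelt 1%g = 1.
Proof. by []. Qed.

Lemma grpeltM g k : grpelt (g * k)%g = grpelt g * grpelt k.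
Proof. by rewrite -grpring_mul_elt. Qed.

End GroupRing.

Section GroupRingMap.
Context (G K : groupType) (f : G -> K).

(* The linear extension of f to the group rings. *)
Definition grpring_map : grpring G -> grpring K :=
  grpring_lift (fun g => grpelt (f g)).

HB.instance Definition _ := GRing.Additive.on grpring_map.

Lemma grpring_map_elt g : grpring_map (grpelt g) = grpelt (f g).
Proof. exact: grpring_lift_elt. Qed.

End GroupRingMap.

Section FoxDerivative.
Context (X : choiceType) (x : X).

Definition is_fox_derivative (D : freegroup X -> grpring (freegroup X)) : Prop :=
  [/\ D (fgen x) = grpelt 1%g,
      forall y, y != x -> D (fgen y) = 0
    & forall u v, D (u * v)%g = D u * grpelt v + D v].

Definition letter_fox (l : X * bool) : grpring (freegroup X) :=
  if l.1 == x then if l.2 then - grpelt ((fgen x)^-1)%g else 1 else 0.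

Fixpoint word_fox (s : seq (X * bool)) : grpring (freegroup X) :=
  if s is l :: s' then
    letter_fox l * grpelt (word_val (@fgen X) s') + word_fox s'
  else 0.

Lemma letter_foxV l :
  letter_fox (letter_inv l) =
  - (letter_fox l * grpelt (letter_val (@fgen X) (letter_inv l))).
Proof.
case: l => y b; rewrite /letter_fox /letter_val /=; case: eqP => [->|_].
  by case: b; rewrite /= ?mul1r // mulNr -grpeltM mulVg opprK.
by rewrite mul0r oppr0.
Qed.

Lemma word_fox_push l s :
  word_fox (push l s) =
  letter_fox l * grpelt (word_val (@fgen X) s) + word_fox s.
Proof.
case: s => [|k s] //=; case: eqP => //= ->.
by rewrite letter_foxV grpeltM addrA mulNr -mulrA subrr add0r.
Qed.

Lemma fox_exists : {D | is_fox_derivative D}.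
Proof.
exists (fun u => word_fox (fword u)); split=> [|y /negPf xy|u v] /=.
- by rewrite addr0 /letter_fox eqxx mul1r.
- by rewrite addr0 /letter_fox /= xy mul0r.
- elim: (fword u) => [|l s IH] /=; first by rewrite mul0r add0r.
  rewrite word_fox_push IH word_val_mul grpeltM mulrDl -!mulrA -addrA.
  by rewrite -[word_val _ (fword v)]/(flift _ v) flift_fgen.
Qed.

Lemma fox_unique D1 D2 :
  is_fox_derivative D1 -> is_fox_derivative D2 -> D1 =1 D2.
Proof.
have D_gen D y : is_fox_derivative D ->
    D (fgen y) = if y == x then grpelt 1%g else 0.
  by case=> Dx Dy _; case: eqP => [->|/eqP /Dy].
have D_1 D : is_fox_derivative D -> D 1%g = 0.
  by case=> _ _ /(_ 1 1)%g/esym/eqP; rewrite mulg1 mulr1 -subr_eq0 addrK => /eqP.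
have D_V D y : is_fox_derivative D ->
    D (fgen y)^-1%g = - (D (fgen y) * grpelt (fgen y)^-1%g).
  move=> fD; case: (fD) => _ _ /(_ (fgen y) (fgen y)^-1)%g.
  by rewrite mulgV D_1 // => /esym/eqP; rewrite addrC addr_eq0 => /eqP.
move=> f1 f2; case: (f1) (f2) => _ _ M1 [_ _ M2].
apply: fgen_ind => [|y u IH|y u IH]; first by rewrite (D_1 _ f1) (D_1 _ f2).
  by rewrite M1 M2 IH (D_gen _ _ f1) (D_gen _ _ f2).
by rewrite M1 M2 IH (D_V _ _ f1) (D_V _ _ f2) (D_gen _ _ f1) (D_gen _ _ f2).
Qed.

Definition fox : freegroup X -> grpring (freegroup X) := sval fox_exists.

Lemma foxP : is_fox_derivative fox.
Proof. exact: svalP fox_exists. Qed.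

End FoxDerivative.

Section RegularWreathProduct.
Context (A : zmodType) (H : finGroupType).

(* The base group is A^#|H|, with copies of A indexed by H; copy_at z h is z(h). *)
Definition copy_at (z : A) (h : H) : {ffun H -> A} :=
  [ffun k => if k == h then z else 0].

Definition base_act (u : {ffun H -> A}) (b : H) : {ffun H -> A} :=
  [ffun k => u (k * b^-1)%g].

Lemma base_act_copy_at z g b :
  base_act (copy_at z g) b = copy_at z (g * b)%g.
Proof.
by apply/ffunP => k; rewrite !ffunE -(inj_eq (mulIg b)) mulgKV.
Qed.

Definition wreath : Type := (H * {ffun H -> A})%type.

HB.instance Definition _ := Choice.on wreath.

Definition wreath_mul (p q : wreath) : wreath :=
  ((p.1 * q.1)%g, base_act p.2 q.1 + q.2).
Definition wreath_one : wreath := (1%g, 0).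
Definition wreath_inv (p : wreath) : wreath :=
  ((p.1^-1)%g, - base_act p.2 p.1^-1%g).

Fact wreath_mulA : associative wreath_mul.
Proof.
case=> [a u] [b v] [c w]; rewrite /wreath_mul /= mulgA addrA; congr (_, _ + _).
by apply/ffunP => k; rewrite !ffunE invMg !mulgA.
Qed.

Fact wreath_mul1l : left_id wreath_one wreath_mul.
Proof.
case=> [a u]; rewrite /wreath_mul /= mul1g; congr (_, _).
by apply/ffunP => k; rewrite !ffunE add0r.
Qed.

Fact wreath_mul1r : right_id wreath_one wreath_mul.
Proof.
case=> [a u]; rewrite /wreath_mul /= mulg1 addr0; congr (_, _).
by apply/ffunP => k; rewrite !ffunE invg1 mulg1.
Qed.

Fact wreath_mulVl : left_inverse wreath_one wreath_inv wreath_mul.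
Proof.
case=> [a u]; rewrite /wreath_mul /= mulVg; congr (_, _).
by apply/ffunP => k; rewrite !ffunE invgK mulgKV addNr.
Qed.

Fact wreath_mulVr : right_inverse wreath_one wreath_inv wreath_mul.
Proof.
by case=> [a u]; rewrite /wreath_mul /= mulgV subrr.
Qed.

HB.instance Definition _ := isGroup.Build wreath
  wreath_mulA wreath_mul1l wreath_mul1r wreath_mulVl wreath_mulVr.

End RegularWreathProduct.

Section GroupRingCoordinates.
Context (H : finGroupType).

(* The isomorphism from ZH to the base group of Z wr H sending g to 1(g). *)
Definition grpring_coord : grpring H -> {ffun H -> int} :=
  grpring_lift (copy_at 1).

HB.instance Definition _ := GRing.Additive.on grpring_coord.

Lemma grpring_coord_elt g : grpring_coord (grpelt g) = copy_at 1 g.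
Proof. exact: grpring_lift_elt. Qed.

Lemma grpring_coordE a g : grpring_coord a g = a@_g.
Proof.
elim/grpring_ind: a => [k|a b IHa IHb].
  by rewrite grpring_coord_elt ffunE mcoeffU eq_sym; case: eqP.
by rewrite raddfB !ffunE IHa IHb mcoeffB.
Qed.

Lemma grpring_coord_bij : bijective grpring_coord.
Proof.
have coefs (v : {ffun H -> int}) g : (\sum_k grpelt k *~ v k : grpring H)@_g = v g.
  rewrite raddf_sum (bigD1 g) //= big1 => [|k /negPf kg].
    by rewrite (raddfMz (mcoeff g)) /= /grpelt mcoeffUU addr0 intz.
  by rewrite (raddfMz (mcoeff g)) /= /grpelt mcoeffU kg mul0rz.
exists (fun v : {ffun H -> int} => \sum_g grpelt g *~ v g) => [a|v].
  by apply/malgP => g; rewrite coefs grpring_coordE.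
by apply/ffunP => g; rewrite grpring_coordE coefs.
Qed.

End GroupRingCoordinates.

Section MagnusMap.
Context (e : nat) (H : finGroupType) (psi : freegroup 'I_e -> H).

Definition zeta : grpring (freegroup 'I_e) -> {ffun H -> int} :=
  @grpring_coord H \o grpring_map psi.

HB.instance Definition _ := GRing.Additive.on zeta.

Definition psi_at (i : 'I_e) : freegroup 'I_e -> wreath int H :=
  flift (fun j =>
    (psi (fgen j), if j == i then copy_at 1 1%g else 0) : wreath int H).

HB.instance Definition _ i := UMagmaMorphism.on (psi_at i).

End MagnusMap.

(* Main.v *)
(* By the Leibniz rule for Fox derivatives, w |-> (psi w, zeta (dw/dx_i)) is a
   homomorphism into the wreath product; it agrees with psi_i on the
   generators, hence everywhere. *)
From HB Require Import structures.
Require Import Defs.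
From mathcomp Require Import all_boot all_algebra all_fingroup.

Set Implicit Arguments.
Unset Strict Implicit.
Unset Printing Implicit Defensive.

Import GRing.Theory.
Local Open Scope ring_scope.

(** The product [(a,u)(b,v) = (ab, u^b + v)] has the same shape as the Fox rule
    [d(uv) = (du)v + dv], once [zeta] turns right multiplication by a group element into the action
    of its image ([zetaMelt]). The equivalence of the two vanishing conditions is injectivity of
    [grpring_coord]. *)

Lemma base_actB (A : zmodType) (H : finGroupType) (u v : {ffun H -> A}) b :
  base_act (u - v) b = base_act u b - base_act v b.
Proof. by apply/ffunP => k; rewrite !ffunE. Qed.

Lemma zeta_elt (e : nat) (H : finGroupType) (psi : freegroup 'I_e -> H) u :
  zeta psi (grpelt u) = copy_at 1 (psi u).
Proof. by rewrite /zeta /= grpring_map_elt grpring_coord_elt. Qed.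

(** Both sides are additive in [a]; on a group element [v] both are [1(psi v * psi u)]. *)
Lemma zetaMelt (e : nat) (H : finGroupType)
    (psi : {multiplicative freegroup 'I_e -> H}) a u :
  zeta psi (a * grpelt u) = base_act (zeta psi a) (psi u).
Proof.
elim/grpring_ind: a => [v|a b IHa IHb].
  by rewrite -grpeltM !zeta_elt gmulfM base_act_copy_at.
by rewrite mulrBl !raddfB /= IHa IHb base_actB.
Qed.

(** Named so that it can carry the multiplicative structure that [flift_unique] expects. *)
Definition magnus_fox (e : nat) (H : finGroupType)
    (psi : freegroup 'I_e -> H) (i : 'I_e) (w : freegroup 'I_e) : wreath int H :=
  (psi w, zeta psi (fox i w)).

Fact magnus_foxM (e : nat) (H : finGroupType)
    (psi : {multiplicative freegroup 'I_e -> H}) (i : 'I_e) :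
  {morph magnus_fox psi i : u v / (u * v)%g}.
Proof.
move=> u v; have [_ _ foxM] := foxP i.
by rewrite /magnus_fox gmulfM foxM raddfD /= zetaMelt.
Qed.

HB.instance Definition _ (e : nat) (H : finGroupType)
    (psi : {multiplicative freegroup 'I_e -> H}) (i : 'I_e) :=
  isMultiplicative.Build _ _ (magnus_fox psi i) (@magnus_foxM e H psi i).

Lemma magnus_fox_gen (e : nat) (H : finGroupType)
    (psi : {multiplicative freegroup 'I_e -> H}) (i j : 'I_e) :
  magnus_fox psi i (fgen j) =
  (psi (fgen j), if j == i then copy_at 1 1%g else 0).
Proof.
(* [psi] is only assumed multiplicative, so preservation of the identity comes from cancellation. *)
have psi1 : psi 1%g = 1%g by apply: (mulgI (psi 1%g)); rewrite -gmulfM !mulg1.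
have [fox_i fox_ne _] := foxP i.
rewrite /magnus_fox; congr (_, _); case: eqP => [->|/eqP ji].
  by rewrite fox_i zeta_elt psi1.
by rewrite fox_ne ?raddf0.
Qed.

Theorem proposition3p6 (e : nat) (H : finGroupType)
    (psi : {multiplicative freegroup 'I_e -> H})
    (psi_surj : forall h : H, exists w : freegroup 'I_e, psi w = h)
    (i : 'I_e) (w : freegroup 'I_e) :
  psi_at psi i w = (psi w, zeta psi (fox i w)) /\
  (zeta psi (fox i w) = 0 <-> grpring_map psi (fox i w) = 0).
Proof.
split.
  apply/esym/(@flift_unique _ _ _ (magnus_fox psi i)) => j.
  exact: magnus_fox_gen.
split=> [z0|p0]; last by rewrite /zeta /= p0 raddf0.
by apply: (bij_inj (@grpring_coord_bij H)); rewrite raddf0.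
Qed.
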